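(* Let $\mathbb{k}$ be a field, $\Lambda$ and $\Gamma$ two semisimple finite-dimensional $\mathbb{k}$-algebras and $\Phi,\Psi:\Lambda\text{-}\mathrm{Mod}\to\Gamma\text{-}\mathrm{Mod}$ two equivalences of categories such that $\Phi_c=\Psi_c$. Then $\Phi\cong\Psi$.
   Context: For an additive category $\mathsf{A}$, its categorical centre $Z(\mathsf{A})$ is the commutative ring of natural endomorphisms of the identity functor. For an equivalence $\Phi:\mathsf{A}\to\mathsf{B}$, the induced ring map $\Phi_c:Z(\mathsf{A})\to Z(\mathsf{B})$ sends $\eta$ to $\vartheta$, where for each $Y\in\mathsf{B}$ one chooses $X_Y\in\mathsf{A}$ and an isomorphism $\xi_Y:\Phi(X_Y)\to Y$ and sets $\vartheta_Y=\xi_Y\circ\Phi(\eta_{X_Y})\circ\xi_Y^{-1}$ (independent of choices). For a ring $A$, $Z(A\text{-}\mathrm{Mod})$ is identified with the centre $Z(A)$ via multiplication maps. *)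

(* Defs.v *)
From HB Require Import structures.
From mathcomp Require Import all_boot all_algebra.
From mathcomp Require Import falgebra.
Set Implicit Arguments. Unset Strict Implicit. Unset Printing Implicit Defensive.
Import GRing.Theory.
Local Open Scope ring_scope.

(* A finite-dimensional k-algebra is an [falgType k].  It is semisimple when
   every left ideal of the left regular module has a complementary left ideal
   (i.e. the regular module is semisimple). *)
Definition left_ideal (k : fieldType) (A : falgType k) (I : {vspace A}) : Prop :=
  (prodv fullv I <= I)%VS.

Definition semisimple_alg (k : fieldType) (A : falgType k) : Prop :=
  forall I : {vspace A}, left_ideal I ->
    exists J : {vspace A}, left_ideal J /\ (I :&: J = 0)%VS /\ (I + J = fullv)%VS.

(* The category A-Mod: objects are left A-modules (lmodType A), morphisms
   are A-linear maps {linear M -> N}; equality of morphisms is equality of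
   the underlying functions. *)
Definition is_iso (R : pzRingType) (M N : lmodType R) (f : {linear M -> N}) : Prop :=
  exists g : {linear N -> M}, cancel f g /\ cancel g f.

Section ModCat.
Variables (A B : pzRingType).


Record functor := Functor {
  fobj : lmodType A -> lmodType B;
  fmor : forall M N : lmodType A, {linear M -> N} -> {linear fobj M -> fobj N};
  fmor_id : forall M : lmodType A,
      (fmor (idfun : {linear M -> M}) : fobj M -> fobj M) =1 id;
  fmor_comp : forall (M N P : lmodType A) (f : {linear M -> N}) (g : {linear N -> P}),
      (fmor (g \o f : {linear M -> P}) : fobj M -> fobj P)
        =1 (fmor g) \o (fmor f)
}.

Definition faithful (F : functor) : Prop :=
  forall (M N : lmodType A) (f g : {linear M -> N}),
    fmor F f =1 fmor F g -> f =1 g.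

Definition full (F : functor) : Prop :=
  forall (M N : lmodType A) (h : {linear fobj F M -> fobj F N}),
    exists f : {linear M -> N}, fmor F f =1 h.

Definition ess_surj (F : functor) : Prop :=
  forall Y : lmodType B, exists (X : lmodType A) (xi : {linear fobj F X -> Y}),
    is_iso xi.

Definition equivalence (F : functor) : Prop :=
  [/\ full F, faithful F & ess_surj F].

Definition nat_iso (F G : functor) : Prop :=
  exists t : forall M : lmodType A, {linear fobj F M -> fobj G M},
    (forall M, is_iso (t M)) /\
    (forall (M N : lmodType A) (f : {linear M -> N}),
        t N \o fmor F f =1 fmor G f \o t M).
End ModCat.

Definition centre_elt (A : pzRingType) (eta : forall M : lmodType A, {linear M -> M}) : Prop :=
  forall (M N : lmodType A) (f : {linear M -> N}), eta N \o f =1 f \o eta M.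

(* [centre_map F eta theta] : theta = F_c eta, i.e. for every Y, every X and
   every isomorphism xi : F X -> Y (with inverse xi'), theta_Y = xi o F(eta_X) o xi'.
   (The definition is independent of choices, so quantifying over all choices
   is the same as the paper's "choose X_Y, xi_Y".) *)
Definition centre_map (A B : pzRingType) (F : functor A B)
    (eta : forall M : lmodType A, {linear M -> M})
    (theta : forall Y : lmodType B, {linear Y -> Y}) : Prop :=
  forall (Y : lmodType B) (X : lmodType A)
         (xi : {linear fobj F X -> Y}) (xi' : {linear Y -> fobj F X}),
    cancel xi xi' -> cancel xi' xi ->
    theta Y =1 xi \o fmor F (eta X) \o xi'.

(* Main.v *)
(* An equivalence Phi is represented by an object Q together with a free
   generator p of Phi Q over Gam. Then N = Psi Q is a Gam-bimodule on which every
   left-linear endomorphism is right multiplication by an element of Gam, and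
   Phi_c = Psi_c says that the centre of Gam acts centrally on N. It suffices to
   find a free generator q of N with a q = q a for all a in Gam: then
   Phi(h) p |-> Psi(h) q is a natural isomorphism. This is a bimodule form of the
   Skolem-Noether theorem. Sub-bimodules of Gam^r are the images of idempotent
   matrices with central entries, so an identity sum a_i x b_i = 0 on Gam also
   holds on N; this yields bimodule maps to N from nonzero two-sided ideals of
   Gam, hence a commuting q with zero annihilator. Finally q generates N: the map
   g corresponding to q satisfies g s g = g for some s, and Psi (g s) is right
   multiplication by an element fixing q, that is, by 1. *)
Require Import Defs.
From HB Require Import structures.
From mathcomp Require Import all_boot all_algebra.
From mathcomp Require Import falgebra.
From mathcomp Require Import zify boolp.
Set Implicit Arguments. Unset Strict Implicit. Unset Printing Implicit Defensive.
Import GRing.Theory.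
Local Open Scope ring_scope.

(** * Linear maps and subspaces given by predicates *)

Lemma linear_ext (R : pzRingType) (M N : lmodType R) (f g : {linear M -> N}) :
  f =1 g -> f = g.
Proof.
case: f g => f [[f0] [f1]] [g [[g0] [g1]]] /= /funext fg.
subst g; rewrite (Prop_irrelevance f0 g0) (Prop_irrelevance f1 g1) //.
Qed.

Lemma exists_linear (R : pzRingType) (M N : lmodType R) (f : M -> N) :
  linear f -> exists g : {linear M -> N}, g =1 f.
Proof.
move=> Hf.
pose m := GRing.isLinear.Build R M N *:%R f Hf.
pose g : {linear M -> N} := HB.pack f m.
by exists g.
Qed.

(** Induction on the codimension of a subspace contained in [P]: unless it exhausts [P], a missing
    vector of [P] is adjoined. *)
Lemma vspace_of_pred (K : fieldType) (V : vectType K) (P : V -> Prop) :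
  P 0 -> (forall a u v, P u -> P v -> P (a *: u + v)) ->
  exists U : {vspace V}, forall v, v \in U <-> P v.
Proof.
move=> P0 PD.
suff H d (U : {vspace V}) : (forall v, v \in U -> P v) ->
    (\dim (fullv : {vspace V}) - \dim U <= d)%N ->
    exists U : {vspace V}, forall v, v \in U <-> P v.
  by apply: (H _ 0%VS _ (leqnn _)) => v; rewrite memv0 => /eqP ->.
elim: d U => [|d IHd] U UP.
  rewrite leqn0 subn_eq0 => dU; exists U => v; split; first exact: UP.
  by move=> _; suff /eqP -> : U == fullv; rewrite ?memvf // eqEdim subvf.
case: (pselect (forall v, P v -> v \in U)) => [PU _|]; first by exists U => v; split; auto.
move=> /existsNP [v /not_implyP [Pv /negP vU]] dU; apply: (IHd (U + <[v]>)%VS).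
  move=> _ /memv_addP [u uU [_ /vlineP [a ->] ->]].
  by rewrite addrC; apply: PD => //; apply: UP.
have: (\dim U < \dim (U + <[v]>)%VS)%N.
  rewrite ltnNge; apply: contra vU => le.
  suff /eqP -> : U == (U + <[v]>)%VS by rewrite memvE addvSr.
  by rewrite eqEdim addvSl.
have := dimvS (subvf (U + <[v]>)%VS); lia.
Qed.

(** * Ideals of a semisimple algebra *)

Definition two_sided (R : nzRingType) (I : R -> Prop) :=
  [/\ I 0, forall x y, I x -> I y -> I (x + y), forall a x, I x -> I (a * x)
    & forall a x, I x -> I (x * a)].

Definition central (R : nzRingType) (z : R) := forall x, z * x = x * z.

Section SemisimpleIdeals.
Variables (K : fieldType) (A : falgType K).
Hypothesis ssA : semisimple_alg A.

Lemma ideal_vspace (I : A -> Prop) :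
    I 0 -> (forall x y, I x -> I y -> I (x + y)) ->
    (forall a x, I x -> I (a * x)) ->
  exists U : {vspace A}, forall x, x \in U <-> I x.
Proof.
move=> I0 ID IM; apply: vspace_of_pred => // a u v Iu Iv.
by apply: ID => //; rewrite -[u]mul1r scalerAl; apply: IM.
Qed.

(** Write [1 = f + g] along a complement [J] of [I]; for [a] in [I], [a - a * f = a * g] lies in
    both [I] and [J]. *)
Lemma left_ideal_right_unit (I : A -> Prop) :
    I 0 -> (forall x y, I x -> I y -> I (x + y)) ->
    (forall a x, I x -> I (a * x)) ->
  exists f, I f /\ forall a, I a -> a * f = a.
Proof.
move=> I0 ID IM; have [U UP] := ideal_vspace I0 ID IM.
have [|J [LJ [UJ0 UJ1]]] := ssA (I := U).
  by apply/prodvP => a u _ /UP Iu; apply/UP/IM.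
have /memv_addP [f fU [g gJ fg]] : 1 \in (U + J)%VS by rewrite UJ1 memvf.
exists f; split; first exact/UP.
move=> a Ia; apply/eqP; rewrite eq_sym -subr_eq0 -memv0 -UJ0 memv_cap.
have E : a - a * f = a * g by rewrite -{1}[a]mulr1 fg mulrDr addrC addKr.
rewrite {2}E (subvP LJ) ?memv_mul ?memvf // andbT.
by rewrite memvB //; apply/UP => //; apply/IM/UP.
Qed.

Lemma von_neumann_regular (a : A) : exists b, a * b * a = a.
Proof.
have [||| f [[b ->] E]] := @left_ideal_right_unit (fun x => exists y, x = y * a).
- by exists 0; rewrite mul0r.
- by move=> _ _ [y ->] [z ->]; exists (y + z); rewrite mulrDl.
- by move=> c _ [y ->]; exists (c * y); rewrite mulrA.
by exists b; rewrite -mulrA; apply: E; exists 1; rewrite mul1r.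
Qed.

(** The right unit [f] is also a left unit: with [c = (1 - f) * a] and [c = c * b * c], the factor
    [a * b * (1 - f)] vanishes because [a * b] is in [I]. Then [f * x = f * x * f = x * f]. *)
Lemma two_sided_unit (I : A -> Prop) : two_sided I ->
  exists f, [/\ I f, central f & forall a, I a -> a * f = a].
Proof.
case=> I0 ID IMl IMr; have [f [If E]] := left_ideal_right_unit I0 ID IMl.
have E' a : I a -> f * a = a.
  move=> Ia; apply/esym/eqP; rewrite -subr_eq0 -{1}[a]mul1r -mulrBl.
  have [b <-] := von_neumann_regular ((1 - f) * a).
  have Iab : I (a * b) by apply: IMr.
  by rewrite -!mulrA [a * (b * _)]mulrA [_ * ((1 - f) * a)]mulrA mulrBr mulr1
    E // subrr mul0r mulr0.
exists f; split=> // x.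
by rewrite -[f * x]E ?[LHS]mulrA; [rewrite -mulrA E' //; apply: IMl | apply: IMr].
Qed.
End SemisimpleIdeals.

(** * Bimodules and operators of the enveloping algebra *)

Definition right_action (A : nzRingType) (N : lmodType A) (R : A -> N -> N) :=
  [/\ forall a, linear (R a), forall a b n, R (a + b) n = R a n + R b n
    & forall a b n, R (a * b) n = R b (R a n)].

(* The action on a bimodule of the element sum of the a (x) b, (a, b) in s, of
   the enveloping algebra. *)
Definition env_op (A : nzRingType) (N : lmodType A) (R : A -> N -> N)
    (s : seq (A * A)) (n : N) : N :=
  \sum_(ab <- s) ab.1 *: R ab.2 n.

Definition regular_right (A : nzRingType) (a : A) (x : A^o) : A^o := x * a.

Lemma regular_right_action (A : nzRingType) : right_action (@regular_right A).
Proof.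
split=> [a b x y|a b x|a b x]; rewrite /regular_right.
- by rewrite mulrDl -scalerAl.
- by rewrite mulrDr.
- by rewrite mulrA.
Qed.

Section RightAction.
Variables (A : nzRingType) (N : lmodType A) (R : A -> N -> N).
Hypothesis RA : right_action R.

Lemma right_actionDr a m n : R a (m + n) = R a m + R a n.
Proof. by case: RA => /(_ a 1 m n); rewrite !scale1r. Qed.

Lemma right_action0 a : R a 0 = 0.
Proof. by apply: (@addIr _ (R a 0)); rewrite -right_actionDr !add0r. Qed.

Lemma right_actionZ a b n : R a (b *: n) = b *: R a n.
Proof. by case: RA => /(_ a b n 0); rewrite !addr0 right_action0 addr0. Qed.

Lemma right_action0l n : R 0 n = 0.
Proof. by case: RA => _ RD _; apply: (@addIr _ (R 0 n)); rewrite -RD !add0r. Qed.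

Lemma right_action_sum a I (r : seq I) (F : I -> N) :
  R a (\sum_(i <- r) F i) = \sum_(i <- r) R a (F i).
Proof. exact: (big_morph _ (right_actionDr a) (right_action0 a)). Qed.

Lemma right_action_suml n I (r : seq I) (F : I -> A) :
  R (\sum_(i <- r) F i) n = \sum_(i <- r) R (F i) n.
Proof.
case: RA => _ RD _.
exact: (big_morph (R^~ n) (fun a b => RD a b n) (right_action0l n)).
Qed.

Lemma env_op_cat s t n : env_op R (s ++ t) n = env_op R s n + env_op R t n.
Proof. exact: big_cat. Qed.

Lemma env_op_mull a s n :
  env_op R [seq (a * x.1, x.2) | x <- s] n = a *: env_op R s n.
Proof.
by rewrite /env_op big_map scaler_sumr; apply: eq_bigr => x _; rewrite scalerA.
Qed.

Lemma env_op_mulr a s n :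
  env_op R [seq (x.1, x.2 * a) | x <- s] n = R a (env_op R s n).
Proof.
case: RA => _ _ RM.
rewrite /env_op big_map right_action_sum; apply: eq_bigr => x _.
by rewrite right_actionZ RM.
Qed.
End RightAction.

Lemma map_mulr_mulmx (A : nzRingType) r (v : 'rV[A]_r) (E : 'M[A]_r) a :
  (forall i j, central (E i j)) ->
  map_mx ( *%R^~ a) v *m E = map_mx ( *%R^~ a) (v *m E).
Proof.
move=> cE; apply/rowP => j; rewrite !mxE mulr_suml; apply: eq_bigr => i _.
by rewrite mxE -!mulrA cE.
Qed.

(** * Sub-bimodules of free modules, and commuting elements *)

Section SemisimpleBimodules.
Variables (K : fieldType) (A : falgType K).
Hypothesis ssA : semisimple_alg A.

(** Induction on [r]. Vectors of [I] with first coordinate 0 are split by [E']; the first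
    coordinates of [I] form a two-sided ideal with central unit [f], and a lift [(f, w1)] of [f] is
    the first row of [E]. *)
Lemma sub_bimodule_split r (I : 'rV[A]_r -> Prop) :
    I 0 -> (forall u v, I u -> I v -> I (u + v)) ->
    (forall a v, I v -> I (a *: v)) ->
    (forall a v, I v -> I (map_mx ( *%R^~ a) v)) ->
  exists E : 'M[A]_r, [/\ forall i j, central (E i j),
    forall v, I (v *m E) & forall v, I v -> v *m E = v].
Proof.
elim: r I => [|r IHr]; last rewrite -[r.+1]/(1 + r)%N; move=> I I0 ID IZ IR.
  exists 0; split=> [[]//|v|v _]; first by rewrite mulmx0.
  by rewrite [RHS]thinmx0 [LHS]thinmx0.
have map_row (a : A) (u : 'rV[A]_1) (w : 'rV[A]_r) :
    map_mx ( *%R^~ a) (row_mx u w : 'rV[A]_(1 + r))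
    = row_mx (map_mx ( *%R^~ a) u) (map_mx ( *%R^~ a) w) by rewrite map_row_mx.
have map_scalar (x a : A) : map_mx ( *%R^~ a) (x%:M : 'rV[A]_1) = (x * a)%:M.
  by apply/rowP => i; rewrite !mxE ord1 eqxx !mulr1n.
have IB u v : I u -> I v -> I (u - v) by move=> Iu Iv; rewrite -scaleN1r; auto.
pose I' (w : 'rV[A]_r) := I (row_mx (0 : 'rV_1) w).
have [||||E' [cE' IE' E'id]] := IHr I'.
- by rewrite /I' row_mx0.
- by move=> u v Iu /(ID _ _ Iu); rewrite add_row_mx addr0.
- by move=> a v /(IZ a); rewrite scale_row_mx scaler0.
- move=> a v /(IR a); rewrite map_row /I'; congr (I (row_mx _ _)).
  by apply/rowP => i; rewrite !mxE mul0r.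
have [|f [[w Iw] cf fid]] := two_sided_unit ssA
  (I := fun a => exists w : 'rV[A]_r, I (row_mx (a%:M : 'rV_1) w)).
  split.
  - by exists 0; rewrite raddf0 row_mx0.
  - move=> x y [v Iv] [w Iw]; exists (v + w).
    by rewrite raddfD -add_row_mx; apply: ID.
  - by move=> a x [v /(IZ a)]; rewrite scale_row_mx scale_scalar_mx; exists (a *: v).
  - by move=> a x [v /(IR a)]; rewrite map_row map_scalar; exists (map_mx ( *%R^~ a) v).
have ff : f * f = f by apply: fid; exists w.
(* Subtracting [w *m E'] ensures [w1 *m E' = 0], while [(f, w1)] stays in [I]. *)
pose w1 := f *: (w - w *m E').
have Iw1 : I (row_mx (f%:M : 'rV_1) w1).
  have := IZ f _ (IB _ _ Iw (IE' w)).
  by rewrite opp_row_mx add_row_mx scale_row_mx oppr0 addr0 scale_scalar_mx ff.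
have E'E' : E' *m E' = E'.
  by apply/row_matrixP => i; rewrite row_mul E'id // rowE.
have w1E' : w1 *m E' = 0.
  by rewrite -scalemxAl mulmxBl -mulmxA E'E' subrr scaler0.
have cw1 i : central (w1 0 i).
  (* The commutator of [a] with [(f, w1)] is [(0, u)], as [f] is central. So [E'] fixes [u], but
     [w1 *m E' = 0] makes it kill [u]. *)
  move=> a; apply/eqP; rewrite eq_sym -subr_eq0.
  pose u := a *: w1 - map_mx ( *%R^~ a) w1.
  suff /rowP /(_ i) : u = 0 by rewrite !mxE => ->.
  rewrite -[u]E'id.
    by rewrite mulmxBl map_mulr_mulmx // -scalemxAl w1E' scaler0 sub0r;
      apply/rowP => j; rewrite !mxE mul0r oppr0.
  have := IB _ _ (IZ a _ Iw1) (IR a _ Iw1).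
  by rewrite map_row map_scalar scale_row_mx scale_scalar_mx opp_row_mx add_row_mx
    cf subrr.
pose E : 'M[A]_(1 + r) := block_mx (f%:M : 'M_1) w1 0 E'.
have EE (x : A) v : row_mx (x%:M : 'rV_1) v *m E
    = row_mx ((x * f)%:M) (x *: w1 + v *m E').
  by rewrite mul_row_block mulmx0 addr0 mul_scalar_mx scale_scalar_mx mul_scalar_mx.
have rowE (v : 'rV[A]_(1 + r)) : v = row_mx ((lsubmx v) 0 0)%:M (rsubmx v).
  by rewrite -mx11_scalar hsubmxK.
exists E; split.
- move=> i j; rewrite -[i]splitK -[j]splitK.
  case: (split i) (split j) => [i1|i1] [j1|j1] /=.
  + by rewrite block_mxEul ord1 [j1]ord1 mxE eqxx mulr1n.
  + by rewrite block_mxEur ord1.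
  + by rewrite block_mxEdl mxE => x; rewrite mul0r mulr0.
  + by rewrite block_mxEdr.
- move=> v; rewrite (rowE v) EE -[(_ * f)%:M]addr0 -add_row_mx.
  by apply: ID; [rewrite -scale_scalar_mx -scale_row_mx; apply: IZ|apply: IE'].
- move=> v; rewrite (rowE v); move: (lsubmx v 0 0) (rsubmx v) => {v} x v Iv.
  have xf : x * f = x by apply: fid; exists v.
  rewrite EE xf; congr row_mx.
  have := IB _ _ Iv (IZ x _ Iw1).
  rewrite scale_row_mx scale_scalar_mx xf opp_row_mx add_row_mx subrr.
  move=> /E'id; rewrite mulmxBl -scalemxAl w1E' scaler0 subr0 => ->.
  by rewrite addrC subrK.
Qed.

Variables (N : lmodType A) (R : A -> N -> N).
Hypothesis RA : right_action R.
Hypothesis Rcentral : forall z, central z -> forall n, R z n = z *: n.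

Notation env_opA := (env_op (@regular_right A)).
Let AA := @regular_right_action A.

(* The relations sum c_i x b_i = 0 valid for all x form a sub-bimodule of A^r,
   hence are generated by relations with central c_i, which hold in N. *)
Lemma env_op_vanish s : (forall x, env_opA s x = 0) -> forall n, env_op R s n = 0.
Proof.
have [_ _ RM] := RA.
pose r := size s; pose b (i : 'I_r) := (nth 0 s i).2.
move=> s0 n.
pose I (v : 'rV[A]_r) := forall x : A, \sum_i v 0 i * (x * b i) = 0.
have [||||E [cE IE Eid]] := @sub_bimodule_split r I.
- by move=> x; apply: big1 => i _; rewrite mxE mul0r.
- move=> u v Iu Iv x; rewrite -[RHS]addr0 -[X in _ = X + _](Iu x) -[X in _ = _ + X](Iv x).
  by rewrite -big_split /=; apply: eq_bigr => i _; rewrite mxE mulrDl.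
- move=> a v Iv x; rewrite -[RHS](mulr0 a) -[X in _ = _ * X](Iv x) mulr_sumr.
  by apply: eq_bigr => i _; rewrite mxE !mulrA.
- move=> a v Iv x; rewrite -[RHS](Iv (a * x)).
  by apply: eq_bigr => i _; rewrite mxE !mulrA.
pose c : 'rV[A]_r := \row_i (nth 0 s i).1.
have /Eid cEE : I c.
  move=> x; rewrite -[RHS](s0 x) /env_op (big_nth 0) big_mkord.
  by apply: eq_bigr => i _; rewrite mxE.
(* Row [j] of [E] is a relation in [I], read at [x = 1]. *)
have Eb j : \sum_i E j i * b i = 0.
  have := IE (delta_mx 0 j) 1; rewrite -rowE => rowE0.
  by rewrite -[RHS]rowE0; apply: eq_bigr => i _; rewrite !mxE mul1r.
rewrite /env_op (big_nth 0) big_mkord.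
transitivity (\sum_i \sum_j c 0 j *: R (E j i * b i) n).
  apply: eq_bigr => i _.
  have -> : (nth 0 s i).1 = (c *m E) 0 i by rewrite cEE mxE.
  rewrite [(c *m E) _ _]mxE scaler_suml; apply: eq_bigr => j _.
  by rewrite -scalerA RM (Rcentral (cE j i)) (right_actionZ RA).
rewrite exchange_big big1 // => j _.
by rewrite -scaler_sumr -(right_action_suml RA) Eb (right_action0l RA) scaler0.
Qed.

(* The list xs separates the operators acting on eN; it is shrunk until its head
   x is needed. Then T |-> T x is injective, modulo operators killing eN, on those
   T that kill the rest of the list, and its image is a two-sided ideal of A. *)
Lemma exists_commuting_of_separating (e : A) (xs : seq A) :
    central e -> e * e = e -> (exists n : N, e *: n <> 0) ->
    (forall s, (forall x, x \in xs -> env_opA s x = 0) ->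
      forall n, e *: env_op R s n = 0) ->
  exists q : N, [/\ q <> 0, e *: q = q & forall a, a *: q = R a q].
Proof.
move=> ce ee [n0 en0].
elim: xs => [|x xs IHxs] sep.
  (* With no points left, [sep] applies to the identity operator. *)
  case: en0; rewrite -(sep [:: (1, 1)] _ n0) // /env_op big_seq1 /=.
  by rewrite Rcentral ?scale1r // => y; rewrite mul1r mulr1.
pose L s := forall y, y \in xs -> env_opA s y = 0.
have [/IHxs //|] := pselect (forall s, L s -> forall n, e *: env_op R s n = 0).
move=> /existsNP [s0 /not_implyP [Ls0 /existsNP [n es0]]].
have [|f [[s1 [Ls1 fE]] cf fid]] := two_sided_unit ssA
    (I := fun a => exists s, L s /\ a = env_opA s x).
  split.
  - by exists [::]; split=> [y _|]; rewrite /env_op big_nil.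
  - move=> _ _ [s [Ls ->]] [t [Lt ->]]; exists (s ++ t).
    by split=> [y yxs|]; rewrite env_op_cat // Ls // Lt // addr0.
  - move=> a _ [s [Ls ->]]; exists [seq (a * ab.1, ab.2) | ab <- s].
    by split=> [y yxs|]; rewrite env_op_mull // Ls // scaler0.
  - move=> a _ [s [Ls ->]]; exists [seq (ab.1, ab.2 * a) | ab <- s].
    by split=> [y yxs|]; rewrite (env_op_mulr AA) // Ls // (right_action0 AA).
(* The operator T of s1 sends x to the central element f and kills xs, so
   a T - T a kills x :: xs, hence eN. *)
exists (e *: env_op R s1 n).
pose u : A := env_opA s0 x.
(* Since [u * f = u], the operators of [s0] and of [u] times [s1] agree on [x :: xs], hence on [N]
   after multiplication by [e]. *)
have s0E : e *: env_op R s0 n = u *: (e *: env_op R s1 n).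
  pose t := s0 ++ [seq (- u * ab.1, ab.2) | ab <- s1].
  have := sep t _ n; rewrite env_op_cat env_op_mull scalerDr scaleNr scalerN.
  rewrite !scalerA ce => E; apply/eqP; rewrite -subr_eq0 E //.
  move=> y; rewrite inE env_op_cat env_op_mull => /predU1P [->|yxs].
    rewrite -fE scaleNr; apply/eqP; rewrite subr_eq0 eq_sym; apply/eqP.
    by apply: fid; exists s0.
  by rewrite Ls0 // Ls1 // scaler0 addr0.
split.
- by move=> q0; case: es0; rewrite s0E q0 scaler0.
- by rewrite scalerA ee.
- move=> a; apply/eqP; rewrite -subr_eq0 (right_actionZ RA).
  pose s1a := [seq (ab.1, ab.2 * a) | ab <- s1].
  pose t := [seq (a * ab.1, ab.2) | ab <- s1] ++ [seq (- 1 * ab.1, ab.2) | ab <- s1a].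
  have := sep t _ n; rewrite env_op_cat !env_op_mull (env_op_mulr RA).
  rewrite scalerDr scaleN1r scalerN !scalerA ce => -> //.
  move=> y; rewrite inE env_op_cat !env_op_mull (env_op_mulr AA).
  move=> /predU1P [->|yxs].
    by rewrite -fE scaleN1r; apply/eqP; rewrite subr_eq0 /regular_right cf.
  by rewrite Ls1 // (right_action0 AA) !scaler0 addr0.
Qed.

(** A [K]-basis of [A] is a separating list: the operators are [K]-linear on [A], and one that
    vanishes on [A] vanishes on [N]. *)
Lemma exists_commuting (e : A) :
    central e -> e * e = e -> (exists n : N, e *: n <> 0) ->
  exists q : N, [/\ q <> 0, e *: q = q & forall a, a *: q = R a q].
Proof.
move=> ce ee en.
apply: (@exists_commuting_of_separating e (vbasis (fullv : {vspace A}))) => //.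
move=> s s0 n; rewrite env_op_vanish ?scaler0 // => x.
rewrite (coord_vbasis (memvf x)) /env_op.
have envZ (c : K) (y : A) : env_opA s (c *: y) = c *: (env_opA s y : A).
  rewrite /env_op scaler_sumr; apply: eq_bigr => ab _.
  transitivity (ab.1 * ((c *: y) * ab.2)) => //.
  by rewrite -scalerAl -scalerAr.
have envD (y z : A) : env_opA s (y + z) = env_opA s y + env_opA s z.
  rewrite /env_op -big_split /=; apply: eq_bigr => ab _.
  by rewrite (right_actionDr AA) scalerDr.
have env0 : env_opA s 0 = 0.
  by apply: big1 => ab _; rewrite (right_action0 AA) scaler0.
rewrite [LHS](big_morph _ envD env0) big1 // => i _.
by rewrite envZ s0 ?scaler0 // mem_nth // size_tuple.
Qed.

Hypothesis Rfaithful : forall a, (forall n, R a n = 0) -> a = 0.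

(** Induction on the dimension of the annihilator of a commuting [q]. It is two-sided, with central
    unit [f]. If [f] is nonzero, faithfulness gives a commuting [q'] fixed by [f], and the
    annihilator of [q + q'] is smaller: it lies in the old one and misses [f]. *)
Lemma exists_free_commuting :
  exists q : N, (forall a, a *: q = R a q) /\ (forall a, a *: q = 0 -> a = 0).
Proof.
have [_ _ RM] := RA.
suff H d (q : N) (U : {vspace A}) :
    (forall a, a *: q = R a q) -> (forall a, a \in U <-> a *: q = 0) ->
    (\dim U <= d)%N ->
    exists q : N, (forall a, a *: q = R a q) /\ (forall a, a *: q = 0 -> a = 0).
  apply: (H _ 0 fullv _ _ (leqnn _)) => a; last by rewrite memvf scaler0.
  by rewrite scaler0 (right_action0 RA).
elim: d q U => [|d IHd] q U qc qU dU.
  exists q; split=> // a /qU.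
  by move: dU; rewrite leqn0 dimv_eq0 => /eqP ->; rewrite memv0 => /eqP.
have [|f [fq cf fid]] := two_sided_unit ssA (I := fun a => a *: q = 0).
  split.
  - by rewrite scale0r.
  - by move=> x y xq yq; rewrite scalerDl xq yq addr0.
  - by move=> a x xq; rewrite -scalerA xq scaler0.
  - by move=> a x xq; rewrite qc RM -qc xq (right_action0 RA).
have [f0|/eqP f0] := eqVneq f 0.
  by exists q; split=> // a /fid; rewrite f0 mulr0.
have [|q' [q'0 fq' q'c]] := exists_commuting cf (fid _ fq).
  have [//|nf] := pselect (exists n : N, f *: n <> 0).
  case: f0; apply: Rfaithful => n; rewrite Rcentral //.
  by apply: contra_notP nf => fn; exists n.
have [|||V VE] := ideal_vspace (I := fun a => a *: (q + q') = 0).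
- by rewrite scale0r.
- by move=> x y xq yq; rewrite scalerDl xq yq addr0.
- by move=> a x xq; rewrite -scalerA xq scaler0.
have VU : (V <= U)%VS.
  apply/subvP => a /VE aq; apply/qU.
  have {}aq : (a * (1 - f)) *: q = 0.
    have <- : (a * (1 - f)) *: (q + q') = (a * (1 - f)) *: q.
      rewrite scalerDr -[X in _ + X]scalerA scalerBl fq' scale1r subrr.
      by rewrite scaler0 addr0.
    by rewrite mulrBr -cf mulr1 scalerBl -scalerA aq scaler0 subrr.
  have := fid _ aq; rewrite -mulrA mulrBl mul1r fid // subrr mulr0.
  move=> /esym/eqP; rewrite mulrBr mulr1 subr_eq0 => /eqP ->.
  by rewrite -scalerA fq scaler0.
apply: (IHd (q + q') V) => //.
  move=> a; rewrite scalerDr (right_actionDr RA) qc q'c //.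
rewrite -ltnS; apply: leq_trans dU; rewrite ltnNge.
apply/negP => le; have /eqP UV : V == U by rewrite eqEdim VU.
have : f \in V by rewrite UV; apply/qU.
by move=> /VE; rewrite scalerDr fq add0r fq'.
Qed.
End SemisimpleBimodules.

(** * Free generators, universal elements and functors *)

Definition free_generator (R : pzRingType) (M : lmodType R) (p : M) :=
  (forall a, a *: p = 0 -> a = 0) /\ (forall y, exists a, y = a *: p).

Lemma free_generator_map (R : pzRingType) (P M : lmodType R) (p : P) (m : M) :
  free_generator p -> exists g : {linear P -> M}, g p = m.
Proof.
move=> [p0 pgen].
have pinj a b : a *: p = b *: p -> a = b.
  by move=> ab; apply/eqP; rewrite -subr_eq0; apply/eqP/p0; rewrite scalerBl ab subrr.
pose c y := projT1 (cid (pgen y)).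
have cE a : c (a *: p) = a by apply/pinj/esym; exact: projT2 (cid (pgen (a *: p))).
have [|g gE] := @exists_linear R P M (fun y => c y *: m).
  move=> a x y; have [b ->] := pgen x; have [d ->] := pgen y.
  by rewrite scalerA -scalerDl !cE scalerDl scalerA.
by exists g; rewrite gE -{1}[p]scale1r cE scale1r.
Qed.

Section Functors.
Variables (A B : pzRingType).

(* By Yoneda, p exhibits the underlying functor of F as Hom(Q, -). *)
Definition universal (F : functor A B) (Q : lmodType A) (p : fobj F Q) :=
  (forall (M : lmodType A) (y : fobj F M), exists h : {linear Q -> M}, fmor F h p = y) /\
  (forall (M : lmodType A) (h h' : {linear Q -> M}), fmor F h p = fmor F h' p -> h = h').

(** [Q] is a preimage of the regular module, and [p] corresponds to [1]. *)
Lemma equivalence_free_generator (F : functor A B) : equivalence F ->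
  exists (Q : lmodType A) (p : fobj F Q), free_generator p.
Proof.
move=> [_ _ /(_ B^o)] [Q [xi [g [xiK gK]]]]; exists Q, (g 1); split=> [a|y].
  by rewrite -linearZ => /(congr1 xi); rewrite gK linear0 /GRing.scale /= mulr1.
by exists (xi y); rewrite -linearZ /GRing.scale /= mulr1 xiK.
Qed.

Lemma free_generator_universal (F : functor A B) Q (p : fobj F Q) :
  full F -> faithful F -> free_generator p -> universal p.
Proof.
move=> fullF faithF pf; split=> [M y|M h h' hh'].
  have [g gp] := free_generator_map y pf; have [h hE] := fullF _ _ g.
  by exists h; rewrite hE.
apply/linear_ext/faithF => y; have [a ->] := pf.2 y.
by rewrite !linearZ hh'.
Qed.

Section Universal.
Variables (F : functor A B) (Q : lmodType A) (p : fobj F Q).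
Hypothesis up : universal p.

(** A [functor] is not additive by definition. Here [y] and [0] come from maps out of [Q], which
    have the same composite with [z]. *)
Lemma fmor_zero (M N : lmodType A) (z : {linear M -> N}) (y : fobj F M) :
  z =1 (fun=> 0) -> fmor F z y = 0.
Proof.
move=> z0; rewrite -(linear0 (fmor F z)).
have [[h <-] [h0 <-]] := (up.1 _ y, up.1 _ (0 : fobj F M)).
rewrite -![fmor F z _]fmor_comp.
by congr (fmor F _ p); apply: linear_ext => x /=; rewrite !z0.
Qed.

(** A representable functor respects the product [N * N], through which [s] factors as the pairing
    of [f] and [g] followed by addition. *)
Lemma fmor_add (M N : lmodType A) (f g s : {linear M -> N}) (y : fobj F M) :
  (forall x, s x = f x + g x) -> fmor F s y = fmor F f y + fmor F g y.
Proof.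
move=> sE.
have [|p1 p1E] := @exists_linear A (N * N)%type N fst; first by [].
have [|p2 p2E] := @exists_linear A (N * N)%type N snd; first by [].
have [|i1 i1E] := @exists_linear A N (N * N)%type (fun x => (x, 0)).
  by move=> a u v; congr pair => //=; rewrite scaler0 addr0.
have [|i2 i2E] := @exists_linear A N (N * N)%type (fun x => (0, x)).
  by move=> a u v; congr pair => //=; rewrite scaler0 addr0.
have [|c cE] := @exists_linear A (N * N)%type N (fun x => x.1 + x.2).
  by move=> a u v; rewrite /= scalerDr addrACA.
have [|w wE] := @exists_linear A M (N * N)%type (fun x => (f x, g x)).
  by move=> a u v; rewrite !linearP.
have joint_inj (d : fobj F (N * N)%type) : fmor F p1 d = 0 -> fmor F p2 d = 0 -> d = 0.
  have [h <-] := up.1 _ d; rewrite -![fmor F _ (fmor F h p)]fmor_comp => d1 d2.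
  pose z : {linear Q -> N} := \0.
  have z0 : fmor F z p = 0 by apply: fmor_zero.
  apply: fmor_zero => x; rewrite [h x]surjective_pairing -p1E -p2E.
  have -> : p1 (h x) = z x by rewrite -(up.2 _ _ _ (etrans d1 (esym z0))).
  by have -> : p2 (h x) = z x by rewrite -(up.2 _ _ _ (etrans d2 (esym z0))).
have FpiK (pj : {linear (N * N)%type -> N}) (ij : {linear N -> (N * N)%type}) v :
    cancel ij pj -> fmor F pj (fmor F ij v) = v.
  move=> ijK; rewrite -[LHS]fmor_comp -[RHS]fmor_id.
  by congr (fmor F _ v); apply: linear_ext => x /=.
have Fpi0 (pj : {linear (N * N)%type -> N}) (ij : {linear N -> (N * N)%type}) v :
    (forall x, pj (ij x) = 0) -> fmor F pj (fmor F ij v) = 0.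
  by move=> ij0; rewrite -[LHS]fmor_comp; apply: fmor_zero.
(* The biproduct identity survives [F], since both projections of the difference vanish. *)
have split_id d : d = fmor F i1 (fmor F p1 d) + fmor F i2 (fmor F p2 d).
  apply/eqP; rewrite -subr_eq0; apply/eqP; apply: joint_inj.
    rewrite linearB linearD FpiK ?Fpi0 ?addr0 ?subrr // => x;
      by rewrite !(p1E, i1E, i2E).
  rewrite linearB linearD [fmor F p2 (fmor F i1 _)]Fpi0 ?FpiK ?add0r ?subrr // => x;
    by rewrite !(p2E, i1E, i2E).
have -> : s = (c \o w : {linear M -> N}).
  by apply: linear_ext => x; rewrite /= cE wE sE.
rewrite [LHS]fmor_comp /= [X in fmor F c X]split_id linearD.
rewrite -![fmor F c _]fmor_comp -![fmor F _ (fmor F w y)]fmor_comp.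
congr (_ + _); rewrite -[LHS]fmor_comp; congr (fmor F _ y); apply: linear_ext => x /=.
  by rewrite cE i1E p1E wE addr0.
by rewrite cE i2E p2E wE add0r.
Qed.
End Universal.

(** [F h p] corresponds to [G h q] by Yoneda; the last hypothesis is what makes this bijection
    [B]-linear. *)
Lemma nat_iso_of_universal (F G : functor A B) (Q : lmodType A)
    (p : fobj F Q) (q : fobj G Q) :
    universal p -> universal q ->
    (forall a (h : {linear Q -> Q}), fmor F h p = a *: p -> fmor G h q = a *: q) ->
  nat_iso F G.
Proof.
move=> up uq pq.
pose hF M y := projT1 (cid (up.1 M y)).
have hFK M y : fmor F (hF M y) p = y := projT2 (cid (up.1 M y)).
pose hG M y := projT1 (cid (uq.1 M y)).
have hGK M y : fmor G (hG M y) q = y := projT2 (cid (uq.1 M y)).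
pose t0 M (y : fobj F M) : fobj G M := fmor G (hF M y) q.
pose u0 M (y : fobj G M) : fobj F M := fmor F (hG M y) p.
have t0E (M : lmodType A) (h : {linear Q -> M}) : t0 M (fmor F h p) = fmor G h q.
  by congr (fmor G _ q); apply: up.2; rewrite hFK.
have u0E (M : lmodType A) (h : {linear Q -> M}) : u0 M (fmor G h q) = fmor F h p.
  by congr (fmor F _ p); apply: uq.2; rewrite hGK.
have t0_linear M : linear (t0 M).
  move=> a x y; rewrite -(hFK M x) -(hFK M y) !t0E.
  (* Scaling by [a] becomes precomposition with [k]: [a *: F h p = F (h \o k) p]. *)
  have [k kp] := up.1 _ (a *: p).
  set h := hF M x; set h' := hF M y.
  have [|s sE] := @exists_linear A Q M (fun x => h (k x) + h' x).
    by move=> b u v; rewrite !linearP /= scalerDr addrACA.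
  have -> : a *: fmor F h p + fmor F h' p = fmor F s p.
    rewrite (@fmor_add F Q p up _ _ (h \o k : {linear Q -> M}) h' s) //.
    by rewrite fmor_comp /= kp linearZ.
  rewrite t0E (@fmor_add G Q q uq _ _ (h \o k : {linear Q -> M}) h' s) //.
  by rewrite fmor_comp /= (pq a k kp) linearZ.
pose t M := projT1 (cid (exists_linear (t0_linear M))).
have tE M : t M =1 t0 M := projT2 (cid (exists_linear (t0_linear M))).
have tK M : cancel (t M) (u0 M) by move=> y; rewrite tE -(hFK M y) t0E u0E.
have uK M : cancel (u0 M) (t M) by move=> y; rewrite tE -(hGK M y) u0E t0E.
exists t; split=> [M|M N f y].
  have [g gE] := exists_linear (can2_linear (tK M) (uK M)).
  by exists g; split=> y; rewrite gE ?tK ?uK.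
rewrite /= !tE -(hFK M y) t0E.
rewrite -[fmor F f _]fmor_comp -[RHS]fmor_comp; exact: t0E.
Qed.
End Functors.

(* The image of F g in the free module on p is a left ideal, generated by an
   idempotent f, so F g splits onto its image. *)
Lemma regular_of_free (A : pzRingType) (K : fieldType) (B : falgType K)
    (F : functor A B) (P Q : lmodType A) (p : fobj F Q) (g : {linear P -> Q}) :
    semisimple_alg B -> equivalence F -> free_generator p ->
  exists s : {linear Q -> P}, forall x, g (s (g x)) = g x.
Proof.
move=> ssB [fullF faithF _] pf.
have [|||f [[y0 y0f] fid]] := left_ideal_right_unit ssB
    (I := fun a => exists y, fmor F g y = a *: p).
- by exists 0; rewrite linear0 scale0r.
- by move=> a b [y ya] [y' yb]; exists (y + y'); rewrite linearD ya yb scalerDl.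
- by move=> a b [y yb]; exists (a *: y); rewrite linearZ yb /= scalerA.
have [s' s'p] := free_generator_map y0 pf; have [s sE] := fullF _ _ s'.
exists s; apply: (faithF _ _ (g \o s \o g : {linear P -> Q}) g) => y.
have [a ya] := pf.2 (fmor F g y).
rewrite !fmor_comp /= !fmor_comp /= ya linearZ /= sE s'p linearZ /= y0f scalerA.
by rewrite fid //; exists y.
Qed.

(** * The bimodule [Psi Q] and its free commuting generator *)

Theorem theorem2p10 (k : fieldType) (Lam Gam : falgType k)
    (Phi Psi : functor Lam Gam) :
  semisimple_alg Lam -> semisimple_alg Gam ->
  equivalence Phi -> equivalence Psi ->
  (forall (eta : forall M : lmodType Lam, {linear M -> M})
          (theta : forall Y : lmodType Gam, {linear Y -> Y}),
      centre_elt eta ->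
      (centre_map Phi eta theta <-> centre_map Psi eta theta)) ->
  nat_iso Phi Psi.
Proof.
move=> _ ssG eqPhi eqPsi PhiPsi.
have [fullPhi faithPhi _] := eqPhi; have [fullPsi faithPsi _] := eqPsi.
have [Q [p pf]] := equivalence_free_generator eqPhi.
have up := free_generator_universal fullPhi faithPhi pf.
(* [Psi] gets its own generator, which makes it additive and later turns [q] into a map
   [Q' -> Q]. *)
have [Q' [p' p'f]] := equivalence_free_generator eqPsi.
have up' := free_generator_universal fullPsi faithPsi p'f.
pose h (a : Gam) := projT1 (cid (up.1 _ (a *: p))).
have hE (a : Gam) : fmor Phi (h a) p = a *: p := projT2 (cid (up.1 _ (a *: p))).
pose N : lmodType Gam := fobj Psi Q.
pose R (a : Gam) (n : N) : N := fmor Psi (h a) n.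
have RA : right_action R.
  split=> [a b m n|a b n|a b n]; first by rewrite /R linearP.
    apply: (fmor_add up') => x.
    have [|s sE] := @exists_linear Lam Q Q (fun x => h a x + h b x).
      by move=> c u v; rewrite !linearP /= scalerDr addrACA.
    rewrite -sE; suff -> : h (a + b) = s by [].
    by apply: up.2; rewrite (fmor_add up p sE) !hE scalerDl.
  rewrite /R -[RHS]fmor_comp; congr (fmor Psi _ n); apply: up.2.
  by rewrite fmor_comp /= !hE linearZ /= hE scalerA.
have Rcentral z : central z -> forall n, R z n = z *: n.
  move=> cz n.
  (* Multiplication by [z] is a central [theta], lifted along [Phi] to [eta]. The hypothesis at
     [Y = N] with [xi] the identity says that [Psi (eta Q)] is multiplication by [z], and
     [eta Q = h z]. *)
  have scal_linear (Y : lmodType Gam) : linear (fun y : Y => z *: y).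
    by move=> a u v; rewrite scalerDr !scalerA cz.
  pose theta Y := projT1 (cid (exists_linear (scal_linear Y))).
  have thetaE Y : theta Y =1 (fun y => z *: y) :=
    projT2 (cid (exists_linear (scal_linear Y))).
  pose eta M := projT1 (cid (fullPhi M M (theta (fobj Phi M)))).
  have etaE M (y : fobj Phi M) : fmor Phi (eta M) y = z *: y.
    rewrite -thetaE.
    exact: projT2 (cid (fullPhi M M (theta (fobj Phi M)))) y.
  have eta_centre : centre_elt eta.
    move=> M P f; apply: (faithPhi _ _ (eta P \o f : {linear _ -> _}) (f \o eta M)).
    by move=> y; rewrite !fmor_comp /= !etaE linearZ.
  have Phi_eta : centre_map Phi eta theta.
    by move=> Y X xi xi' _ xi'K y /=; rewrite thetaE etaE linearZ /= xi'K.
  have Psi_eta := (PhiPsi eta theta eta_centre).1 Phi_eta.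
  have := Psi_eta N Q idfun idfun (fun=> erefl) (fun=> erefl) n.
  rewrite thetaE /= => ->; congr (fmor Psi _ n).
  by apply: up.2; rewrite hE etaE.
have Rfaithful a : (forall n, R a n = 0) -> a = 0.
  move=> Ra0; apply: pf.1; rewrite -hE; apply: (fmor_zero up) => x.
  pose z : {linear Q -> Q} := \0.
  rewrite (_ : h a x = z x) //; apply: faithPsi => n.
  by rewrite [LHS]Ra0 [RHS](fmor_zero up').
have [q [qc q0]] := exists_free_commuting ssG RA Rcentral Rfaithful.
have [g gq] := up'.1 _ q.
have [s gsg] := regular_of_free g ssG eqPhi pf.
have [c cE] := pf.2 (fmor Phi (g \o s : {linear Q -> Q}) p).
have hc : g \o s = h c :> {linear Q -> Q} by apply: up.2; rewrite hE.
(* Psi (g o s) is right multiplication by c and fixes q, which is right-free. *)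
have c1 : c = 1.
  apply/eqP; rewrite -subr_eq0; apply/eqP/q0.
  rewrite scalerBl scale1r qc /R -hc -gq -[fmor Psi _ _]fmor_comp.
  apply/eqP; rewrite subr_eq0; apply/eqP; congr (fmor Psi _ p').
  exact/linear_ext.
have qf : free_generator q.
  (* As [c = 1], [g \o s] is the identity, so [n = Psi g (Psi s n) = Psi g (b *: p') = b *: q]. *)
  split=> // n; have [b bE] := p'f.2 (fmor Psi s n); exists b.
  rewrite -gq -linearZ -bE -[RHS]fmor_comp -[LHS]fmor_id.
  congr (fmor Psi _ n); apply: up.2; rewrite cE c1 scale1r; exact: fmor_id.
apply: (nat_iso_of_universal up (free_generator_universal fullPsi faithPsi qf)).
by move=> a h' h'E; rewrite qc; congr (fmor Psi _ q); apply: up.2; rewrite hE.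
Qed.
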